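(* Let $U\subset\mathbb R^n$ be a neighborhood of $0$, let $f:U\to\mathbb R$ be a function and let $\delta$ be a positive infinitesimal. If ${}^*f(\xi)=0$ for all $\xi\in B_\delta$, then there is another neighborhood $V\subset\mathbb R^n$ of $0$ such that $f|_V$ is identically zero, i.e. $[f]$ is the zero germ. That is, the map $\mathcal R_\delta:\mathcal G_0\to{}^\sigma F(B_\delta)$, $[f]\mapsto{}^*f|_{B_\delta}$, is an $\mathbb R$-algebra isomorphism.
   Context: Work in a sufficiently saturated nonstandard extension ${}^*$ of a superstructure over $\mathbb R$. $B_\delta=\{\xi\in{}^*\mathbb R^n:|\xi|\le\delta\}$. $\mathcal G_0$ is the ring (an $\mathbb R$-algebra without unit) of germs at $0\in\mathbb R^n$ of functions $(\mathbb R^n,0)\to(\mathbb R,0)$. ${}^\sigma F(B_\delta)$ is the (external) $\mathbb R$-algebra of standard functions on $B_\delta$, i.e. the restrictions ${}^*f|_{B_\delta}$ of transfers of such standard functions $f$ defined on a neighborhood of $0$ in $\mathbb R^n$. *)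

(* Defs.v *)
From HB Require Import structures.
From mathcomp Require Import all_boot all_order all_algebra generic_quotient.
From mathcomp Require Import all_classical all_reals all_analysis.

Set Implicit Arguments.
Unset Strict Implicit.
Unset Printing Implicit Defensive.
Import Order.TTheory GRing.Theory Num.Theory.
Import numFieldNormedType.Exports.

Local Open Scope classical_set_scope.
Local Open Scope ring_scope.
Local Open Scope quotient_scope.

(* The cumulative levels V_0 = X, V_(k+1) = V_k \cup P(V_k), inside a type
   [T] equipped with a membership relation [mem] and individuals [atom x]. *)
Fixpoint level (X T : Type) (mem : T -> T -> Prop) (atom : X -> T) (k : nat) :
    set T :=
  if k is k'.+1 then
    level mem atom k' `|`
      [set a | ~ range atom a /\ [set c | mem c a] `<=` level mem atom k']
  else range atom.

(* [superstructure X] is V(X), presented by its defining properties, which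
   determine it up to a unique isomorphism over [X]: it is the union of the
   V_k, individuals have no members, sets are extensional, and every subset of
   V_k is an element. *)
Record superstructure (X : Type) := Superstructure {
  ssort :> Type;
  smem : ssort -> ssort -> Prop;
  satom : X -> ssort;
  satom_inj : injective satom;
  satom_nomem : forall c x, ~ smem c (satom x);
  sext : forall a b, ~ range satom a -> ~ range satom b ->
    (forall c, smem c a <-> smem c b) -> a = b;
  scompr : forall k (A : set ssort), A `<=` level smem satom k ->
    exists a, ~ range satom a /\ forall c, smem c a <-> A c;
  slevel : forall a, exists k, level smem satom k a }.

Section Codes.
Variables (X : Type) (V : superstructure X).

Definition sempty : V := sval (cid (scompr (@sub0set _ (level (@smem _ V) _ 0)))).

(* The set of V(X) whose members are the elements of [A]; it exists whenever
   [A] is included in some V_k, and is the junk value [sempty] otherwise. *)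
Definition coll (A : set V) : V :=
  if pselect (exists a, ~ range (@satom _ V) a /\ forall c, smem c a <-> A c)
    is left h then sval (cid h) else sempty.

Definition spair (a b : V) : V := coll [set coll [set a]; coll [set a; b]].

(* (x_1, ..., x_n) is coded as (x_1, (x_2, ... (x_n, \emptyset))). *)
Definition stuple n (x : 'rV[X]_n) : V :=
  foldr spair sempty [seq satom V (x ord0 i) | i <- enum 'I_n].

Definition sgraph n (A : set 'rV[X]_n) (f : 'rV[X]_n -> X) : V :=
  coll [set spair (stuple x) (satom V (f x)) | x in A].

End Codes.

(* Variables are de Bruijn indices; in [BAll j phi], i.e. "for all x \in v_j,
   phi", the bound variable x has index 0 in [phi]. *)
Inductive bformula : Type :=
| BMem of nat & nat
| BEq of nat & nat
| BNot of bformula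
| BAnd of bformula & bformula
| BAll of nat & bformula.

Definition scons_env (T : Type) (x : T) (e : nat -> T) : nat -> T :=
  fun i => if i is i'.+1 then e i' else x.

Fixpoint bsat (X : Type) (V : superstructure X) (e : nat -> V)
    (phi : bformula) : Prop :=
  match phi with
  | BMem i j => smem (e i) (e j)
  | BEq i j => e i = e j
  | BNot p => ~ bsat e p
  | BAnd p q => bsat e p /\ bsat e q
  | BAll j p => forall x : V, smem x (e j) -> bsat (scons_env x e) p
  end.

Record nonstandard_extension (R : Type) := NonstandardExtension {
  starR : Type;
  stdV : superstructure R;
  nstV : superstructure starR;
  star : stdV -> nstV;
  std : R -> starR;
  star_base : star (coll (range (satom stdV))) = coll (range (satom nstV));
  star_atom : forall r, star (satom stdV r) = satom nstV (std r);
  transfer : forall (phi : bformula) (e : nat -> stdV),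
    bsat e phi <-> bsat (star \o e) phi }.

Arguments star {R} _ _.
Arguments std {R} _ _.

Section Extension.
Variables (R : Type) (E : nonstandard_extension R).

Definition internal (b : nstV E) : Prop := exists a, smem b (star E a).

(* |K|^+-saturation in the usual cardinal terminology. *)
Definition saturated (K : Type) : Prop :=
  forall C : K -> nstV E,
    (forall k, internal (C k)) ->
    (forall F : set K, finite_set F -> exists x, forall k, F k -> smem x (C k)) ->
    exists x, forall k, smem x (C k).

Definition star_set n (A : set 'rV[R]_n) : set 'rV[starR E]_n :=
  [set xi | smem (stuple (nstV E) xi)
              (star E (coll [set stuple (stdV E) x | x in A]))].

Definition star_graph n (A : set 'rV[R]_n) (f : 'rV[R]_n -> R)
    (xi : 'rV[starR E]_n) (y : starR E) : Prop :=
  smem (spair (stuple (nstV E) xi) (satom (nstV E) y))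
    (star E (sgraph (stdV E) A f)).

End Extension.
Arguments star_set {R} E {n} A _.

Section RealExtension.
Variables (R : realType) (E : nonstandard_extension R).

(* The transfer of the function [f : A -> R], i.e. of [f] restricted to [A],
   as a function on *A; its value is the junk 0 outside *A. *)
Definition star_fun n (A : set 'rV[R]_n) (f : 'rV[R]_n -> R)
    (xi : 'rV[starR E]_n) : starR E :=
  if pselect (exists y, star_graph A f xi y) is left h
    then sval (cid h) else std E 0.

Definition row2 (T : Type) (x y : T) : 'rV[T]_2 :=
  \row_(i < 2) if i == ord0 then x else y.

Definition star_op2 (op : R -> R -> R) (x y : starR E) : starR E :=
  star_fun setT (fun z : 'rV[R]_2 => op (z ord0 ord0) (z ord0 ord_max))
    (row2 x y).

Definition star_rel2 (r : R -> R -> bool) (x y : starR E) : Prop :=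
  star_set E [set z : 'rV[R]_2 | r (z ord0 ord0) (z ord0 ord_max)] (row2 x y).

Definition star_add := star_op2 (fun a b => a + b).
Definition star_mul := star_op2 (fun a b => a * b).
Definition star_opp (x : starR E) : starR E :=
  star_fun setT (fun z : 'rV[R]_1 => - z ord0 ord0) (\row_(_ < 1) x).
Definition star_le := star_rel2 (fun a b => a <= b).
Definition star_lt := star_rel2 (fun a b => a < b).

Definition enorm n (x : 'rV[R]_n) : R := Num.sqrt (\sum_i x ord0 i ^+ 2).

Definition star_norm n : 'rV[starR E]_n -> starR E := star_fun setT (@enorm n).

Definition infinitesimal_ball n (delta : starR E) : set 'rV[starR E]_n :=
  [set xi | star_le (star_norm xi) delta].

Definition pos_infinitesimal (delta : starR E) : Prop :=
  star_lt (std E 0) delta /\ forall r : R, 0 < r -> star_lt delta (std E r).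

End RealExtension.
Arguments infinitesimal_ball {R E n} delta _.
Arguments pos_infinitesimal {R E} delta.

Record alg_ops (K A : Type) := AlgOps {
  alg0 : A;
  algD : A -> A -> A;
  algN : A -> A;
  algM : A -> A -> A;
  algZ : K -> A -> A }.

(* Algebras are commutative and without unit; the axioms are relative to [S]. *)
Record is_algebra (K : pzRingType) (A : Type) (o : alg_ops K A) (S : set A) :
    Prop := IsAlgebra {
  alg_closed0 : S (alg0 o);
  alg_closedD : forall x y, S x -> S y -> S (algD o x y);
  alg_closedN : forall x, S x -> S (algN o x);
  alg_closedM : forall x y, S x -> S y -> S (algM o x y);
  alg_closedZ : forall k x, S x -> S (algZ o k x);
  alg_addA : forall x y z, S x -> S y -> S z ->
    algD o x (algD o y z) = algD o (algD o x y) z;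
  alg_addC : forall x y, S x -> S y -> algD o x y = algD o y x;
  alg_add0 : forall x, S x -> algD o (alg0 o) x = x;
  alg_addN : forall x, S x -> algD o (algN o x) x = alg0 o;
  alg_mulA : forall x y z, S x -> S y -> S z ->
    algM o x (algM o y z) = algM o (algM o x y) z;
  alg_mulC : forall x y, S x -> S y -> algM o x y = algM o y x;
  alg_mulD : forall x y z, S x -> S y -> S z ->
    algM o (algD o x y) z = algD o (algM o x z) (algM o y z);
  alg_scaleA : forall k l x, S x -> algZ o k (algZ o l x) = algZ o (k * l) x;
  alg_scale1 : forall x, S x -> algZ o 1 x = x;
  alg_scaleDr : forall k x y, S x -> S y ->
    algZ o k (algD o x y) = algD o (algZ o k x) (algZ o k y);
  alg_scaleDl : forall k l x, S x ->
    algZ o (k + l) x = algD o (algZ o k x) (algZ o l x);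
  alg_scaleM : forall k x y, S x -> S y ->
    algZ o k (algM o x y) = algM o (algZ o k x) y }.

Record is_alg_iso (K : pzRingType) (A B : Type) (oA : alg_ops K A)
    (oB : alg_ops K B) (S : set A) (T : set B) (phi : A -> B) : Prop := IsAlgIso {
  alg_iso_dom : is_algebra oA S;
  alg_iso_codom : is_algebra oB T;
  alg_iso_bij : set_bij S T phi;
  alg_isoD : forall x y, S x -> S y -> phi (algD oA x y) = algD oB (phi x) (phi y);
  alg_isoM : forall x y, S x -> S y -> phi (algM oA x y) = algM oB (phi x) (phi y);
  alg_isoZ : forall k x, S x -> phi (algZ oA k x) = algZ oB k (phi x) }.

(* The partial function defined on [lf_dom]; only the values of [lf_fun] there
   matter. *)
Record local_fun (R : realType) (n : nat) := LocalFun {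
  lf_dom : set 'rV[R]_n;
  lf_fun :> 'rV[R]_n -> R;
  lf_nbhs : nbhs (0 : 'rV[R]_n) lf_dom;
  lf_at0 : lf_fun 0 = 0 }.

HB.instance Definition _ (R : realType) n := gen_eqMixin (local_fun R n).
HB.instance Definition _ (R : realType) n := gen_choiceMixin (local_fun R n).

Section Germs.
Variables (R : realType) (n : nat).
Implicit Types f g : local_fun R n.

Definition same_germ f g : Prop :=
  exists W : set 'rV[R]_n, [/\ nbhs (0 : 'rV[R]_n) W, W `<=` lf_dom f `&` lf_dom g &
    forall x, W x -> f x = g x].

Lemma same_germP f g : same_germ f g <-> \forall x \near (0 : 'rV[R]_n), f x = g x.
Proof.
split=> [[W [W0 _ fg]]|fg]; first by apply: filterS W0.
exists (lf_dom f `&` lf_dom g `&` [set x | f x = g x]); split.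
- by apply: filterI => //; apply: filterI; apply: lf_nbhs.
- by move=> x [].
- by move=> x [].
Qed.

Definition germ_rel f g : bool := `[< same_germ f g >].

Lemma germ_rel_refl : reflexive germ_rel.
Proof. by move=> f; apply/asboolP/same_germP; near=> x. Unshelve. all: end_near. Qed.

Lemma germ_rel_sym : symmetric germ_rel.
Proof.
by move=> f g; apply/idP/idP => /asboolP/same_germP h; apply/asboolP/same_germP;
  apply: filterS h.
Qed.

Lemma germ_rel_trans : transitive germ_rel.
Proof.
move=> g f h /asboolP/same_germP fg /asboolP/same_germP gh.
by apply/asboolP/same_germP; apply: filterS2 fg gh => x -> ->.
Qed.

Canonical germ_equiv :=
  EquivRel germ_rel germ_rel_refl germ_rel_sym germ_rel_trans.

Definition germ := {eq_quot germ_equiv}.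
HB.instance Definition _ := EqQuotient.on germ.

Definition germ_of f : germ := \pi_germ f.

Lemma germ_ofP f g : germ_of f = germ_of g <-> same_germ f g.
Proof. by split=> [/eqmodP/asboolP|fg]; [|apply/eqmodP/asboolP]. Qed.

Lemma lf_zero_at0 : (fun _ : 'rV[R]_n => 0 : R) 0 = 0.
Proof. by []. Qed.
Definition lf_zero : local_fun R n := LocalFun filterT lf_zero_at0.

Lemma lf_add_at0 f g : (fun x => f x + g x) 0 = 0.
Proof. by rewrite /= !lf_at0 addr0. Qed.
Definition lf_add f g : local_fun R n :=
  LocalFun (filterI (lf_nbhs f) (lf_nbhs g)) (lf_add_at0 f g).

Lemma lf_opp_at0 f : (fun x => - f x) 0 = 0.
Proof. by rewrite /= lf_at0 oppr0. Qed.
Definition lf_opp f : local_fun R n := LocalFun (lf_nbhs f) (lf_opp_at0 f).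

Lemma lf_mul_at0 f g : (fun x => f x * g x) 0 = 0.
Proof. by rewrite /= !lf_at0 mulr0. Qed.
Definition lf_mul f g : local_fun R n :=
  LocalFun (filterI (lf_nbhs f) (lf_nbhs g)) (lf_mul_at0 f g).

Lemma lf_scale_at0 (k : R) f : (fun x => k * f x) 0 = 0.
Proof. by rewrite /= lf_at0 mulr0. Qed.
Definition lf_scale k f : local_fun R n :=
  LocalFun (lf_nbhs f) (lf_scale_at0 k f).

Definition germ_ops : alg_ops R germ := {|
  alg0 := germ_of lf_zero;
  algD := fun a b => germ_of (lf_add (repr a) (repr b));
  algN := fun a => germ_of (lf_opp (repr a));
  algM := fun a b => germ_of (lf_mul (repr a) (repr b));
  algZ := fun k a => germ_of (lf_scale k (repr a)) |}.

Lemma same_germ_repr f : \forall x \near (0 : 'rV[R]_n), repr (germ_of f) x = f x.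
Proof. by apply/same_germP/germ_ofP; rewrite /germ_of reprK. Qed.

Lemma germ_addE f g :
  algD germ_ops (germ_of f) (germ_of g) = germ_of (lf_add f g).
Proof.
apply/germ_ofP/same_germP.
by apply: filterS2 (same_germ_repr f) (same_germ_repr g) => x /= -> ->.
Qed.

Lemma germ_oppE f : algN germ_ops (germ_of f) = germ_of (lf_opp f).
Proof.
by apply/germ_ofP/same_germP; apply: filterS (same_germ_repr f) => x /= ->.
Qed.

Lemma germ_mulE f g :
  algM germ_ops (germ_of f) (germ_of g) = germ_of (lf_mul f g).
Proof.
apply/germ_ofP/same_germP.
by apply: filterS2 (same_germ_repr f) (same_germ_repr g) => x /= -> ->.
Qed.

Lemma germ_scaleE k f : algZ germ_ops k (germ_of f) = germ_of (lf_scale k f).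
Proof.
by apply/germ_ofP/same_germP; apply: filterS (same_germ_repr f) => x /= ->.
Qed.

End Germs.

Section StandardFunctions.
Variables (R : realType) (E : nonstandard_extension R) (n : nat).
Variable delta : starR E.

Definition ball_fun : Type :=
  {xi : 'rV[starR E]_n | infinitesimal_ball delta xi} -> starR E.

Definition ball_restr (f : local_fun R n) : ball_fun :=
  fun xi => star_fun (E := E) (lf_dom f) f (sval xi).

Definition standard_ball_fun : set ball_fun := range ball_restr.

Definition ball_fun_ops : alg_ops R ball_fun := {|
  alg0 := fun _ => std E 0;
  algD := fun g h xi => star_add (g xi) (h xi);
  algN := fun g xi => star_opp (g xi);
  algM := fun g h xi => star_mul (g xi) (h xi);
  algZ := fun k g xi => star_mul (std E k) (g xi) |}.

End StandardFunctions.

Arguments ball_fun {R E} n delta.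
Arguments standard_ball_fun {R E} n delta _.
Arguments ball_fun_ops {R E} n delta.
Arguments ball_restr {R E n} delta f.

(* Main.v *)
Require Import Defs.
From HB Require Import structures.
From mathcomp Require Import all_boot all_order all_algebra.
From mathcomp Require Import all_classical all_reals all_analysis.

Import Order.TTheory GRing.Theory Num.Theory.
Import numFieldNormedType.Exports.

Local Open Scope classical_set_scope.
Local Open Scope ring_scope.

(* Every set A of R^n transfers to *A, and *f is a well-defined function on *A
   for f : A -> R.  A neighborhood A of 0 contains a standard ball, so *A
   contains B_delta; hence *f on B_delta depends only on the germ of f.
   Conversely, suppose that every neighborhood of 0 meets A.  Then for every
   real r > 0 there is x in A with |x| <= r; transferring this sentence and
   instantiating r with delta gives a point of *A in B_delta.  Applied to the
   set A where f and g differ, this shows that germs with the same restriction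
   to B_delta coincide.  The only nonstandard tool is transfer. *)

(** * Sets and Kuratowski pairs inside a superstructure *)

Section Superstructure.
Context {X : Type} {V : superstructure X}.
Implicit Types (a b c : V) (A B : set V).

Local Notation lev := (level (@smem _ V) (@satom _ V)).

Lemma level_le i j : (i <= j)%N -> lev i `<=` lev j.
Proof.
elim: j => [|j IH]; first by rewrite leqn0 => /eqP->.
by rewrite leq_eqVlt => /predU1P[->//|/IH ij a /ij]; left.
Qed.

Lemma sempty_spec :
  ~ range (satom V) (sempty V) /\ forall c, ~ smem c (sempty V).
Proof. by rewrite /sempty; case: cid => a [/= ? h]; split=> // c /h. Qed.

Lemma sempty_level : lev 1 (sempty V).
Proof. by right; have [? h] := sempty_spec; split=> // c /h. Qed.

Lemma coll_spec k {A} : A `<=` lev k ->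
  ~ range (satom V) (coll A) /\ forall c, smem c (coll A) <-> A c.
Proof.
move=> Ak; rewrite /coll; case: pselect => [h|[]]; first by case: cid.
by have [a] := scompr Ak; exists a.
Qed.

Lemma smem_coll k {A} : A `<=` lev k -> forall c, smem c (coll A) <-> A c.
Proof. by move=> /coll_spec[]. Qed.

Lemma coll_level k A : A `<=` lev k -> lev k.+1 (coll A).
Proof.
by move=> Ak; right; have [? h] := coll_spec _ Ak; split=> // c /h /Ak.
Qed.

Lemma smem_atomF a b : smem a b -> ~ range (satom V) b.
Proof. by move=> ab [x _ xb]; rewrite -xb in ab; exact: satom_nomem ab. Qed.

Lemma coll_eq {A b} k : A `<=` lev k -> ~ range (satom V) b ->
  (forall c, smem c b <-> A c) -> b = coll A.
Proof.
move=> /coll_spec[h1 h2] nb h; apply: sext => // c.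
by rewrite h h2.
Qed.

Lemma set2_level k a b : lev k a -> lev k b -> [set a; b] `<=` lev k.
Proof. by move=> ? ? c [->|->]. Qed.

Lemma common_level a b : exists k, lev k a /\ lev k b.
Proof.
have [[i ia] [j jb]] := (slevel a, slevel b); exists (maxn i j).
split; first exact: level_le (leq_maxl i j) _ ia.
exact: level_le (leq_maxr i j) _ jb.
Qed.

Lemma smem_coll2 a b c : smem c (coll [set a; b]) <-> c = a \/ c = b.
Proof.
by have [k [ka kb]] := common_level a b; exact/smem_coll/(set2_level k).
Qed.

(** The right-hand side quantifies over members of [u] only, so a bounded formula can express it.
    Having a member makes [u] a non-individual, and extensionality applies. *)
Lemma coll2P a b u :
  u = coll [set a; b] <->
  [/\ smem a u, smem b u & forall z, smem z u -> z = a \/ z = b].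
Proof.
split=> [->|[au bu h]].
  by split=> [||z]; rewrite smem_coll2; [left|right|].
have [k [ka kb]] := common_level a b.
apply: (coll_eq k) => [||c]; [exact: set2_level|exact: smem_atomF au|].
by split=> [/h//|[]->].
Qed.

(** Again bounded by [p]. The singleton is written {a, a} so that one formula for unordered pairs
    serves both members. *)
Lemma spairP a b p : p = spair a b <->
  [/\ smem (coll [set a; a]) p, smem (coll [set a; b]) p &
    forall u, smem u p -> u = coll [set a; a] \/ u = coll [set a; b]].
Proof. by rewrite -coll2P setUid. Qed.

Lemma spair_level k a b : lev k a -> lev k b -> lev k.+2 (spair a b).
Proof.
move=> ka kb; apply/coll_level/set2_level; apply: coll_level.
  by move=> c ->.
exact: set2_level.
Qed.

Lemma coll2_inj a b c : coll [set a; b] = coll [set a; c] -> b = c.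
Proof.
move=> h; have := smem_coll2 a b b; have := smem_coll2 a c c.
rewrite -h smem_coll2 h smem_coll2 => -[_ /(_ (or_intror erefl)) hc].
case=> _ /(_ (or_intror erefl)) hb.
by case: hb hc => [->|//] [->|->].
Qed.

Lemma spair_inj a b a' b' : spair a b = spair a' b' -> a = a' /\ b = b'.
Proof.
move=> h; have [_ h2 h3] := (spairP a b _).1 erefl.
have [h1' h2' h3'] := (spairP a' b' _).1 erefl.
rewrite -h in h1' h2' h3'.
have aa' : a = a'.
  have : smem a (coll [set a'; a']).
    by case: (h3 _ h1') => ->; apply/smem_coll2; left.
  by rewrite smem_coll2 => -[].
split=> //; rewrite -{}aa' in h2' h3'.
(* If {a, b} = {a, a}, then b = a and the pair has {a, a} as its only member, so {a, b'} = {a, a}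
   and b' = a as well. *)
case: (h3' _ h2) => /coll2_inj // ba; rewrite ba in h3 h2'.
by case: (h3 _ h2') => /coll2_inj ->.
Qed.

End Superstructure.

(** * Codes of tuples, of sets of tuples and of graphs *)

Section Tuples.
Context {X : Type} {V : superstructure X}.

Local Notation lev := (level (@smem _ V) (@satom _ V)).

(** This is the code under [star] in [star_set], so x is in *A exactly when its tuple is a member of
    [star E (scode A)]. *)
Definition scode {n} (A : set 'rV[X]_n) : V := coll [set stuple V x | x in A].

Lemma stuple0 (x : 'rV[X]_0) : stuple V x = sempty V.
Proof. by rewrite /stuple (size0nil (size_enum_ord 0)). Qed.

Lemma stupleS n (x : 'rV[X]_n.+1) : stuple V x =
  spair (satom V (x ord0 ord0)) (stuple V (\row_i x ord0 (lift ord0 i))).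
Proof.
rewrite /stuple enum_ordSl /=; congr (spair _ (foldr _ _ _)).
by rewrite -map_comp; apply: eq_map => i /=; rewrite mxE.
Qed.

Lemma stuple_inj n : injective (@stuple X V n).
Proof.
elim: n => [|n IH] x y; first by move=> _; apply/rowP => -[].
rewrite !stupleS => /spair_inj[h0 /IH/rowP h]; have {}h0 := satom_inj h0.
apply/rowP => i; case: (unliftP ord0 i) => [j|] ->//.
by have := h j; rewrite !mxE.
Qed.

Lemma satom_level k x : lev k (satom V x).
Proof. by apply: (level_le 0%N) => //; exists x. Qed.

(** Each coordinate costs one pair, that is two levels. The bound depends on n alone, so every set
    of n-tuples lies in a single level and its [coll] is not the junk value. *)
Lemma stuple_level n (x : 'rV[X]_n) : lev n.*2.+1 (stuple V x).
Proof.
elim: n x => [|n IH] x; first by rewrite stuple0; exact: sempty_level.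
by rewrite stupleS; apply/spair_level; [exact: satom_level|exact: IH].
Qed.

Lemma smem_scode n (A : set 'rV[X]_n) c :
  smem c (scode A) <-> exists2 x, A x & stuple V x = c.
Proof. by apply: smem_coll => _ [x _ <-]; exact: stuple_level. Qed.

Lemma stuple_scode n (A : set 'rV[X]_n) x : smem (stuple V x) (scode A) <-> A x.
Proof. by rewrite smem_scode; split=> [[y Ay /stuple_inj<-//]|]; exists x. Qed.

Lemma smem_satoms c :
  smem c (coll (range (satom V))) <-> exists x, c = satom V x.
Proof.
rewrite (@smem_coll _ _ 0%N) //; split; first by case=> x _ <-; exists x.
by case=> x ->; exists x.
Qed.

Lemma smem_sgraph n (A : set 'rV[X]_n) f c :
  smem c (sgraph V A f) <->
  exists2 x, A x & spair (stuple V x) (satom V (f x)) = c.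
Proof.
apply: smem_coll => _ [x _ <-].
by apply: spair_level; [exact: stuple_level|exact: satom_level].
Qed.

Lemma spair_sgraph n (A : set 'rV[X]_n) f x y :
  smem (spair (stuple V x) (satom V y)) (sgraph V A f) <-> A x /\ f x = y.
Proof.
rewrite smem_sgraph; split=> [[z Az /spair_inj[zx fz]]|[Ax <-]].
  by rewrite -(stuple_inj _ _ _ zx) (satom_inj fz).
by exists x.
Qed.

Lemma stuple_row1 (x : X) :
  stuple V (\row_(_ < 1) x) = spair (satom V x) (sempty V).
Proof. by rewrite stupleS stuple0 mxE. Qed.

Lemma stuple_row2 (x y : X) :
  stuple V (row2 x y) = spair (satom V x) (spair (satom V y) (sempty V)).
Proof.
rewrite !stupleS stuple0 !mxE /=; congr (spair _ (spair (satom _ _) _)).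
Qed.

End Tuples.

(* A convenient sublanguage of [bformula] with pairing terms: [TCst k] is the
   k-th parameter, [TVar i] a de Bruijn index counting bound variables only,
   and the number carried by [FMem], [FAll] and [FEx] is that of a parameter. *)
Inductive term := TVar of nat | TCst of nat | TPair of term & term.

Inductive formula :=
| FMem of term & nat
| FEq of nat & term
| FNot of formula
| FAnd of formula & formula
| FImp of formula & formula
| FAll of nat & formula
| FEx of nat & formula.

(** * Semantics of the language with pairs and its compilation to bounded formulas *)

Section Semantics.
Context {X : Type} {V : superstructure X}.
Variable c : nat -> V.

(** Bound variables are stacked on the parameters: parameter k has index [size s + k]. *)
Definition env (s : seq V) : nat -> V := foldr (@scons_env V) c s.

Fixpoint tval (s : seq V) (t : term) : V :=
  match t with
  | TVar i => env s i
  | TCst k => c k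
  | TPair t u => spair (tval s t) (tval s u)
  end.

Fixpoint sat (s : seq V) (p : formula) : Prop :=
  match p with
  | FMem t k => smem (tval s t) (c k)
  | FEq i t => env s i = tval s t
  | FNot p => ~ sat s p
  | FAnd p q => sat s p /\ sat s q
  | FImp p q => sat s p -> sat s q
  | FAll k p => forall x, smem x (c k) -> sat (x :: s) p
  | FEx k p => exists2 x, smem x (c k) & sat (x :: s) p
  end.

End Semantics.

Definition bimp p q := BNot (BAnd p (BNot q)).
Definition bor p q := BNot (BAnd (BNot p) (BNot q)).
Definition bex j p := BNot (BAll j (BNot p)).
(** [bdouble] and [bpair] spell out the bounded characterizations [coll2P] and [spairP]; the
    successors skip the variable just bound. *)
Definition bdouble u a b :=
  BAnd (BAnd (BMem a u) (BMem b u)) (BAll u (bor (BEq 0 a.+1) (BEq 0 b.+1))).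
Definition bpair p a b :=
  BAnd (BAnd (bex p (bdouble 0 a.+1 a.+1)) (bex p (bdouble 0 a.+1 b.+1)))
    (BAll p (bor (bdouble 0 a.+1 a.+1) (bdouble 0 a.+1 b.+1))).

(* "v_q = t" where the variables of [t] are shifted by [l] and its constants
   by [l + d]. *)
Fixpoint bterm l d q t :=
  match t with
  | TVar i => BEq q (l + i)
  | TCst k => BEq q (l + (d + k))
  | TPair t u =>
    bex q (bex 0 (bex q.+2 (bex 0
      (BAnd (bpair q.+4 2 0) (BAnd (bterm l.+4 d 2 t) (bterm l.+4 d 0 u))))))
  end.

(* [d] is the number of enclosing quantifiers. *)
Fixpoint compile d p :=
  match p with
  | FMem t k => bex (d + k) (bterm 1 d 0 t)
  | FEq i t => bterm 0 d i t
  | FNot p => BNot (compile d p)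
  | FAnd p q => BAnd (compile d p) (compile d q)
  | FImp p q => bimp (compile d p) (compile d q)
  | FAll k p => BAll (d + k) (compile d.+1 p)
  | FEx k p => bex (d + k) (compile d.+1 p)
  end.

Section Compile.
Context {X : Type} {V : superstructure X}.
Implicit Types (e : nat -> V).

Arguments bsat : simpl never.

Lemma bsat_imp e p q : bsat e (bimp p q) <-> (bsat e p -> bsat e q).
Proof.
split=> [/= h hp|h /= [hp]]; last by apply; exact: h.
by apply: contrapT => nq; exact: h.
Qed.

Lemma bsat_or e p q : bsat e (bor p q) <-> bsat e p \/ bsat e q.
Proof.
split=> [/= h|[h|h] /= []//].
case: (pselect (bsat e p)) => hp; [by left|right].
by apply: contrapT => ?; exact: h.
Qed.

Lemma bsat_ex e j p :
  bsat e (bex j p) <-> exists2 x, smem x (e j) & bsat (scons_env x e) p.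
Proof.
split=> [/= h|[x xj xp] /= h]; last exact: h xp.
by apply: contrapT => nh; apply: h => x xj xp; apply: nh; exists x.
Qed.

Lemma bsat_eq e i j : bsat e (BEq i j) <-> e i = e j.
Proof. by []. Qed.

Lemma bsat_not e p : bsat e (BNot p) <-> ~ bsat e p.
Proof. by []. Qed.

Lemma bsat_and e p q : bsat e (BAnd p q) <-> bsat e p /\ bsat e q.
Proof. by []. Qed.

Lemma bsat_all e j p :
  bsat e (BAll j p) <-> forall x, smem x (e j) -> bsat (scons_env x e) p.
Proof. by []. Qed.

Lemma bsat_double e u a b :
  bsat e (bdouble u a b) <-> e u = coll [set e a; e b].
Proof.
rewrite coll2P !bsat_and bsat_all; split=> [[[au bu] h]|[au bu h]].
  by split=> // z /h/bsat_or.
by split=> // z /h ?; apply/bsat_or.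
Qed.

Lemma bsat_pair e p a b : bsat e (bpair p a b) <-> e p = spair (e a) (e b).
Proof.
rewrite spairP !bsat_and !bsat_ex bsat_all; split.
  move=> [[[x xp hx] [y yp hy]] h].
  move: hx hy; rewrite !bsat_double /= => hx hy.
  split=> [||u]; rewrite -?hx -?hy //.
  by move/h; rewrite bsat_or !bsat_double hx hy.
move=> [h1 h2 h]; split; first split.
- by exists (coll [set e a; e a]) => //; apply/bsat_double.
- by exists (coll [set e a; e b]) => //; apply/bsat_double.
- by move=> u /h ?; apply/bsat_or; rewrite !bsat_double.
Qed.

(** The components of a pair are members of a member of it, namely {a, b}; this is what lets [bterm]
    reach them by bounded quantifiers. *)
Lemma spair_mem (a b p : V) : p = spair a b ->
  exists2 u, smem u p & smem a u /\ smem b u.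
Proof.
move=> /spairP[_ h _]; exists (coll [set a; b]) => //.
by split; apply/smem_coll2; [left|right].
Qed.

Variable c : nat -> V.

Lemma env_size s k : env c s (size s + k) = c k.
Proof. by elim: s => //= x s; rewrite addSn. Qed.

(** The first [l] entries of [e] are auxiliary variables. Each pair crossed adds four of them: x1 in
    the pair, x2 in x1, x3 in the pair, x4 in x3, where x2 and x4 are the components, at indices 2
    and 0. Hence the induction is over all [e], [l] and [q]. *)
Lemma bsat_term s t e l q : (forall i, e (l + i)%N = env c s i) ->
  bsat e (bterm l (size s) q t) <-> e q = tval c s t.
Proof.
elim: t e l q => [i|k|t IHt u IHu] e l q he.
- by rewrite bsat_eq he.
- by rewrite bsat_eq he env_size.
have IH (x1 x2 x3 x4 : V) :
    let e' := scons_env x4 (scons_env x3 (scons_env x2 (scons_env x1 e))) in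
    bsat e' (BAnd (bpair q.+4 2 0)
      (BAnd (bterm l.+4 (size s) 2 t) (bterm l.+4 (size s) 0 u))) <->
    [/\ e q = spair x2 x4, x2 = tval c s t & x4 = tval c s u].
  move=> e'; have he' i : e' (l.+4 + i)%N = env c s i by rewrite -he.
  rewrite bsat_and bsat_pair bsat_and (IHt e' _ 2%N he') (IHu e' _ 0%N he').
  by split=> [[? []]|[]].
split.
  move=> /bsat_ex[x1 _ /bsat_ex[x2 _ /bsat_ex[x3 _ /bsat_ex[x4 _]]]].
  by move=> /IH[-> -> ->].
(* One member [x] of the pair contains both components and serves as x1 and as x3. *)
move=> eq; have [x xq [tx ux]] := spair_mem _ _ _ eq.
apply/bsat_ex; exists x => //; apply/bsat_ex; exists (tval c s t) => //.
apply/bsat_ex; exists x => //; apply/bsat_ex; exists (tval c s u) => //.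
by apply/IH.
Qed.

Lemma bsat_compile p s : bsat (env c s) (compile (size s) p) <-> sat c s p.
Proof.
elim: p s => [t k|i t|p IH|p IHp q IHq|p IHp q IHq|k p IH|k p IH] s.
(* Atoms of [bformula] relate variables only, so membership of t in the k-th parameter reads: some
   member of that parameter equals t. *)
- have termP x := bsat_term s t (scons_env x (env c s)) 1 0 (fun=> erefl).
  rewrite bsat_ex env_size /=; split=> [[x xk /termP<- //]|h].
  by exists (tval c s t) => //; apply/termP.
- by rewrite [compile _ _]/= (bsat_term s).
- by rewrite bsat_not IH.
- by rewrite bsat_and IHp IHq.
- by rewrite bsat_imp IHp IHq.
- rewrite bsat_all env_size.
  by split=> h x xk; apply/(IH (x :: s)); exact: h.
- rewrite bsat_ex env_size.
  by split=> -[x xk h]; exists x => //; apply/(IH (x :: s)).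
Qed.

End Compile.

(** The arbitrary goal [Q] lets one [apply:] leave two tasks: prove the sentence in the standard
    superstructure, then use its transfer. *)
Lemma sat_transfer {R : Type} (E : nonstandard_extension R) p
    (c : nat -> stdV E) (Q : Prop) :
  sat c [::] p -> (sat (star E \o c) [::] p -> Q) -> Q.
Proof.
by rewrite -(bsat_compile c p [::]) -(bsat_compile _ p [::]) /= transfer; auto.
Qed.

(** The type [T] has no distinguished element, so the entries come from the emptiness of ['I_0]. *)
Definition row_nil {T : Type} : 'rV[T]_0 :=
  \row_(i < 0) let: Ordinal _ lti0 := i in False_rect _ (notF lti0).

Definition row_cons {T : Type} {n} (x : T) (y : 'rV[T]_n) : 'rV[T]_n.+1 :=
  \row_i oapp (y ord0) x (unlift ord0 i).

Lemma stuple_cons {X : Type} {V : superstructure X} {n} x (y : 'rV[X]_n) :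
  stuple V (row_cons x y) = spair (satom V x) (stuple V y).
Proof.
rewrite stupleS mxE unlift_none; congr (spair _ (stuple V _)).
by apply/rowP => i; rewrite !mxE liftK.
Qed.

(** * Transfer of the empty set and of sets of tuples *)

Section Star.
Context {R : Type} {E : nonstandard_extension R}.
Local Notation V := (stdV E).
Local Notation W := (nstV E).
Local Notation base := (coll (range (satom V))).
(** The parameters of a sentence, numbered by their position in the list. *)
Local Notation consts s := (nth (sempty V) s).

Lemma satom_base x : smem (satom V x) base.
Proof. by apply/smem_satoms; exists x. Qed.

Lemma satom_star_base x : smem (satom W x) (star E base).
Proof. by rewrite star_base; apply/smem_satoms; exists x. Qed.

Lemma smem_star_base c : smem c (star E base) -> exists x, c = satom W x.
Proof. by rewrite star_base => /smem_satoms. Qed.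

Lemma star_empty : star E (sempty V) = sempty W.
Proof.
have [nV mV] := @sempty_spec _ V; have [nW mW] := @sempty_spec _ W.
(* The sentence says that the empty set is not an individual and that each of its members x
   satisfies x <> x. The first half is needed because extensionality concerns non-individuals. *)
apply: (sat_transfer E (FAnd (FNot (FMem (TCst 0) 1))
  (FAll 0 (FNot (FEq 0 (TVar 0))))) (consts [:: sempty V; base])) => [|[nb mb]].
  by split=> [/smem_satoms[x ex]|x /mV//]; apply: nV; exists x.
apply: sext => //= [[x _ ex]|c].
  by apply: nb; rewrite /= -ex; exact: satom_star_base.
by split=> [/mb|/mW] //=.
Qed.

(** Induction on the standard number n: transfer that (n+1)-tuples are exactly the pairs of an
    individual and an n-tuple. By [star_base] the starred set of individuals consists of all
    individuals of [W]. *)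
Lemma star_tuples n c :
  smem c (star E (scode (V := V) [set: 'rV[R]_n])) <->
  exists x : 'rV[starR E]_n, c = stuple W x.
Proof.
elim: n c => [|n IH] c.
  apply: (sat_transfer E (FAnd (FMem (TCst 0) 1)
    (FAll 1 (FEq 0 (TCst 0))))
    (consts [:: sempty V; scode [set: 'rV[R]_0]])) => [|/= [m0 h0]].
    split=> [|x /smem_scode[y _ <-]]; last exact: stuple0.
    by rewrite /= -(stuple0 row_nil); apply/stuple_scode.
  rewrite star_empty in m0 h0; split=> [/h0->|[x ->]]; last by rewrite stuple0.
  by exists row_nil; rewrite stuple0.
apply: (sat_transfer E (FAnd
  (FAll 2 (FEx 0 (FEx 1 (FEq 2 (TPair (TVar 1) (TVar 0))))))
  (FAll 0 (FAll 1 (FMem (TPair (TVar 1) (TVar 0)) 2))))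
  (consts [:: base; scode [set: 'rV[R]_n]; scode [set: 'rV[R]_n.+1]])) =>
  [|/= [h1 h2]].
  split=> /= [p /smem_scode[x _ <-]|a /smem_satoms[x ->] b /smem_scode[y _ <-]].
    exists (satom V (x ord0 ord0)); first exact: satom_base.
    exists (stuple V (\row_i x ord0 (lift ord0 i))); first exact/stuple_scode.
    exact: stupleS.
  by rewrite -stuple_cons; apply/stuple_scode.
split=> [/h1[a /smem_star_base[x ->] [b /IH[y ->]] ->]|[x ->]].
  by exists (row_cons x y); rewrite stuple_cons.
by rewrite stupleS; apply: h2; [exact: satom_star_base|apply/IH; eexists].
Qed.

(** Transfer the inclusion of A in R^n and apply [star_tuples]. *)
Lemma star_codeP n (A : set 'rV[R]_n) c :
  smem c (star E (scode (V := V) A)) ->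
  exists2 x, star_set E A x & c = stuple W x.
Proof.
apply: (sat_transfer E (FAll 0 (FMem (TVar 0) 1))
  (consts [:: scode A; scode [set: 'rV[R]_n]])) =>
    [_ /smem_scode[x _ <-]|] /=.
  exact/stuple_scode.
move=> h Ac; have /star_tuples[x cx] := h _ Ac.
by exists x; rewrite // /star_set /= -cx.
Qed.

(** * Transfer of graphs of functions *)

Section Sets.
Context {n : nat}.
Implicit Types (A B : set 'rV[R]_n) (f g : 'rV[R]_n -> R).

Lemma stuple_star_tuples (x : 'rV[starR E]_n) :
  smem (stuple W x) (star E (scode (V := V) [set: 'rV[R]_n])).
Proof. by apply/star_tuples; exists x. Qed.

Lemma star_setT (x : 'rV[starR E]_n) : star_set E setT x.
Proof. exact: stuple_star_tuples. Qed.

Lemma star_graph_dom A f x y : star_graph (E := E) A f x y -> star_set E A x.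
Proof.
apply: (sat_transfer E
  (FAll 1 (FAll 0 (FImp (FMem (TPair (TVar 1) (TVar 0)) 2) (FMem (TVar 1) 3))))
  (consts [:: base; scode [set: 'rV[R]_n]; sgraph V A f; scode A])) =>
    [_ /smem_scode[a _ <-] _ /smem_satoms[b ->]|] /=.
  by move=> /spair_sgraph[Aa _]; apply/stuple_scode.
by move=> h xy; apply: h xy; [exact: stuple_star_tuples|exact: satom_star_base].
Qed.

Lemma star_graph_total A f x :
  star_set E A x -> exists y, star_graph (E := E) A f x y.
Proof.
apply: (sat_transfer E (FAll 1 (FEx 0 (FMem (TPair (TVar 1) (TVar 0)) 2)))
  (consts [:: base; scode A; sgraph V A f])) => [_ /smem_scode[a Aa <-]|] /=.
  exists (satom V (f a)); first exact: satom_base.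
  exact/spair_sgraph.
by move=> h /h[_ /smem_star_base[y ->] xy]; exists y.
Qed.

Lemma star_graph_fun A f x y z :
  star_graph (E := E) A f x y -> star_graph A f x z -> y = z.
Proof.
apply: (sat_transfer E (FAll 1 (FAll 0 (FAll 0
    (FImp (FMem (TPair (TVar 2) (TVar 1)) 2)
      (FImp (FMem (TPair (TVar 2) (TVar 0)) 2) (FEq 1 (TVar 0)))))))
  (consts [:: base; scode [set: 'rV[R]_n]; sgraph V A f])) =>
    [_ /smem_scode[a _ <-] _ /smem_satoms[b ->] _ /smem_satoms[c ->]|] /=.
  by move=> /spair_sgraph[_ <-] /spair_sgraph[_ <-].
move=> h xy xz; apply: satom_inj.
have sb := @satom_star_base.
exact: (h _ (stuple_star_tuples x) _ (sb y) _ (sb z) xy xz).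
Qed.

Lemma star_graph_sub A B f x y : A `<=` B ->
  star_graph (E := E) A f x y -> star_graph B f x y.
Proof.
move=> AB; apply: (sat_transfer E (FAll 0 (FMem (TVar 0) 1))
  (consts [:: sgraph V A f; sgraph V B f])) =>
    [_ /smem_sgraph[a /AB Ba <-]|] /=.
  exact/spair_sgraph.
by move=> + xy; apply.
Qed.

(** No transfer is involved: functions that agree on A have the same coded graph. *)
Lemma eq_star_graph A f g : (forall x, A x -> f x = g x) ->
  star_graph (E := E) A f = star_graph A g.
Proof.
move=> fg; suff fgE : sgraph V A f = sgraph V A g by rewrite /star_graph fgE.
by congr coll; apply: eq_imagel => x Ax; rewrite fg.
Qed.

Lemma star_graph_cst k (x : 'rV[starR E]_n) :
  star_graph (E := E) setT (fun=> k) x (std E k).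
Proof.
apply: (sat_transfer E (FAll 0 (FMem (TPair (TVar 0) (TCst 1)) 2))
  (consts [:: scode [set: 'rV[R]_n]; satom V k; sgraph V setT (fun=> k)])) =>
    [_ /smem_scode[a _ <-]|] /=.
  exact/spair_sgraph.
by move=> /(_ _ (stuple_star_tuples x)); rewrite star_atom.
Qed.

(** A generic [op] covers sums, products and scalar multiples with a single sentence. *)
Lemma star_graph_comp2 A B f g (op : R -> R -> R) x a b c :
  star_graph (E := E) A f x a -> star_graph B g x b ->
  star_graph setT (fun z : 'rV[R]_2 => op (z ord0 ord0) (z ord0 ord_max))
    (row2 a b) c ->
  star_graph (A `&` B) (fun x => op (f x) (g x)) x c.
Proof.
set ope := (fun z => _).
(* The variables 3, 2, 1, 0 are x, a, b, c, and [TCst 6] is the empty set that ends the code of the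
   row (a, b). *)
apply: (sat_transfer E (FAll 1 (FAll 0 (FAll 0 (FAll 0
    (FImp (FMem (TPair (TVar 3) (TVar 2)) 2)
    (FImp (FMem (TPair (TVar 3) (TVar 1)) 3)
    (FImp (FMem (TPair (TPair (TVar 2) (TPair (TVar 1) (TCst 6))) (TVar 0)) 4)
      (FMem (TPair (TVar 3) (TVar 0)) 5))))))))
  (consts [:: base; scode [set: 'rV[R]_n]; sgraph V A f; sgraph V B g;
    sgraph V setT ope; sgraph V (A `&` B) (fun x => op (f x) (g x));
    sempty V])) =>
      [_ /smem_scode[p _ <-] _ /smem_satoms[q ->] _
      /smem_satoms[r ->] _ /smem_satoms[s ->]|] /=.
  rewrite -stuple_row2.
  move=> /spair_sgraph[Ap <-] /spair_sgraph[Bp <-] /spair_sgraph[_ <-].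
  by apply/spair_sgraph; rewrite /ope !mxE.
rewrite star_empty => h xa xb; rewrite /star_graph stuple_row2 => xc.
by apply: h xa xb xc; [exact: stuple_star_tuples|..]; exact: satom_star_base.
Qed.

Lemma star_graph_comp1 A f (op : R -> R) x a c :
  star_graph (E := E) A f x a ->
  star_graph setT (fun z : 'rV[R]_1 => op (z ord0 ord0)) (\row_(_ < 1) a) c ->
  star_graph A (fun x => op (f x)) x c.
Proof.
set ope := (fun z => _).
apply: (sat_transfer E (FAll 1 (FAll 0 (FAll 0
    (FImp (FMem (TPair (TVar 2) (TVar 1)) 2)
    (FImp (FMem (TPair (TPair (TVar 1) (TCst 5)) (TVar 0)) 3)
      (FMem (TPair (TVar 2) (TVar 0)) 4))))))
  (consts [:: base; scode [set: 'rV[R]_n]; sgraph V A f;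
    sgraph V setT ope; sgraph V A (fun x => op (f x)); sempty V])) =>
      [_ /smem_scode[p _ <-] _ /smem_satoms[q ->] _ /smem_satoms[r ->]|] /=.
  rewrite -stuple_row1 => /spair_sgraph[Ap <-] /spair_sgraph[_ <-].
  by apply/spair_sgraph; rewrite /ope !mxE.
rewrite star_empty => h xa; rewrite /star_graph stuple_row1 => xc.
by apply: h xa xc; [exact: stuple_star_tuples|..]; exact: satom_star_base.
Qed.

(** Over P the two graphs are disjoint, and this is a bounded sentence. *)
Lemma star_graph_neq P A B f g x y z : P `<=` A -> P `<=` B ->
  (forall x, P x -> f x <> g x) -> star_set E P x ->
  star_graph (E := E) A f x y -> star_graph B g x z -> y <> z.
Proof.
move=> PA PB fg.
apply: (sat_transfer E (FAll 1 (FAll 0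
    (FImp (FMem (TPair (TVar 1) (TVar 0)) 2)
      (FNot (FMem (TPair (TVar 1) (TVar 0)) 3)))))
  (consts [:: base; scode P; sgraph V A f; sgraph V B g])) =>
    [_ /smem_scode[p Pp <-] _ /smem_satoms[q ->]|] /=.
  by move=> /spair_sgraph[_ <-] /spair_sgraph[_ /esym]; exact: fg.
move=> h Px xy xz yz; move: xz; rewrite -yz.
exact: h _ Px _ (satom_star_base _) xy.
Qed.

End Sets.

End Star.

(** * Euclidean balls and neighborhoods of 0 *)

Section EuclideanNorm.
Context {R : realType} {n : nat}.

(** The topology of ['rV[R]_n] comes from the sup norm, and each |x_j| is at most [enorm x]. *)
Lemma nbhs_enorm (W : set 'rV[R]_n) : nbhs (0 : 'rV[R]_n) W ->
  exists2 r : R, 0 < r & forall x, enorm x < r -> W x.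
Proof.
move=> /nbhs_ballP[r /= r0 rW]; exists r => // x xr; apply: rW; split=> // i j.
rewrite /ball /= mxE sub0r normrN ord1; apply: le_lt_trans xr.
rewrite -sqrtr_sqr ler_sqrt; last by apply: sumr_ge0 => k _; exact: sqr_ge0.
by rewrite (bigD1 j) //= lerDl; apply: sumr_ge0 => k _; exact: sqr_ge0.
Qed.

Lemma enorm_nbhs (r : R) : 0 < r -> nbhs (0 : 'rV[R]_n) [set x | enorm x <= r].
Proof.
(* With this radius each x_i^2 is at most r^2 / (n+1), so the n squares add up to at most r^2.
   Dividing by n+1 rather than n keeps the radius positive when n = 0. *)
move=> r0; apply/nbhs_ballP; exists (r / n.+1%:R) => /= [|x [_ xr]].
  by rewrite divr_gt0.
rewrite /= /enorm -[leRHS](ger0_norm (ltW r0)) -sqrtr_sqr ler_sqrt ?sqr_ge0//.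
have xi i : x ord0 i ^+ 2 <= r ^+ 2 / n.+1%:R.
  have := xr ord0 i; rewrite /ball /= mxE sub0r normrN => /ltW h.
  rewrite -real_normK ?num_real//.
  apply: (@le_trans _ _ ((r / n.+1%:R) ^+ 2)).
    by rewrite lerXn2r ?nnegrE// divr_ge0// ltW.
  rewrite expr_div_n ler_wpM2l ?sqr_ge0// lef_pV2 ?posrE ?exprn_gt0//.
  by rewrite expr2 ler_peMr// ler1n.
apply: (le_trans (ler_sum _ (fun i _ => xi i))).
rewrite sumr_const card_ord -[leLHS]mulr_natr -mulrA ler_piMr ?sqr_ge0//.
by rewrite mulrC ler_pdivrMr// mul1r ler_nat.
Qed.

End EuclideanNorm.

(** * Values of transferred functions *)

Section StarFunctions.
Context {R : realType} {E : nonstandard_extension R} {n : nat}.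
Implicit Types (A : set 'rV[R]_n) (f : 'rV[R]_n -> R) (x : 'rV[starR E]_n).

Lemma star_fun_graph A f x :
  star_set E A x -> star_graph A f x (star_fun A f x).
Proof.
move=> Ax; rewrite /star_fun; case: pselect => [h|[]]; first by case: cid.
exact: star_graph_total.
Qed.

Lemma star_funE A f x y : star_graph A f x y -> star_fun A f x = y.
Proof.
move=> xy; apply: (star_graph_fun A f x) => //.
exact/star_fun_graph/star_graph_dom/xy.
Qed.

Lemma star_fun_graph_setT f x : star_graph setT f x (star_fun setT f x).
Proof. exact/star_fun_graph/star_setT. Qed.

End StarFunctions.

Section Transfer.
Context {R : realType} {E : nonstandard_extension R} {n : nat}.
Implicit Types (A B : set 'rV[R]_n) (f g : 'rV[R]_n -> R) (x : 'rV[starR E]_n).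
Local Notation V := (stdV E).
Local Notation base := (coll (range (satom V))).
Local Notation consts s := (nth (sempty V) s).

Lemma star_fun_cst k x : star_fun setT (fun=> k) x = std E k.
Proof. exact/star_funE/star_graph_cst. Qed.

Lemma star_fun_sub D A f x : D `<=` A -> star_set E D x ->
  star_fun A f x = star_fun D f x.
Proof. by move=> DA Dx; apply/star_funE/(star_graph_sub D)/star_fun_graph. Qed.

Lemma eq_star_fun D A B f g x : D `<=` A -> D `<=` B ->
  (forall y, D y -> f y = g y) -> star_set E D x ->
  star_fun A f x = star_fun B g x.
Proof.
move=> DA DB fg Dx; rewrite (star_fun_sub D A)// (star_fun_sub D B)//.
by rewrite /star_fun (eq_star_graph _ _ _ fg).
Qed.

Lemma star_fun_neq D A B f g x : D `<=` A -> D `<=` B ->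
  (forall y, D y -> f y <> g y) -> star_set E D x ->
  star_fun A f x <> star_fun B g x.
Proof.
move=> DA DB fg Dx; rewrite (star_fun_sub D A)// (star_fun_sub D B)//.
by apply: (star_graph_neq D D D f g x) => //; exact: star_fun_graph.
Qed.

Lemma star_fun_op2 A B f g (op : R -> R -> R) x :
  star_set E A x -> star_set E B x ->
  star_fun (A `&` B) (fun y => op (f y) (g y)) x =
  star_op2 op (star_fun A f x) (star_fun B g x).
Proof.
move=> Ax Bx; apply/star_funE/star_graph_comp2; try exact: star_fun_graph.
exact/star_fun_graph/star_setT.
Qed.

Lemma star_fun_opp A f x : star_set E A x ->
  star_fun A (fun y => - f y) x = star_opp (star_fun A f x).
Proof.
move=> Ax; apply/star_funE/(star_graph_comp1 _ _ -%R).
  exact: star_fun_graph.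
exact/star_fun_graph/star_setT.
Qed.

(** * The infinitesimal ball and neighborhoods of 0 *)

Variable delta : starR E.
Hypothesis delta_inf : pos_infinitesimal delta.

Lemma ball_star_nbhs A x : nbhs (0 : 'rV[R]_n) A ->
  infinitesimal_ball delta x -> star_set E A x.
Proof.
move=> /nbhs_enorm[r r0 rA] xdelta; have [_ /(_ r r0)] := delta_inf.
move: xdelta; rewrite /infinitesimal_ball/= /star_lt /star_le /star_rel2 /star_set.
pose LE := [set z : 'rV[R]_2 | z ord0 ord0 <= z ord0 ord_max].
pose LT := [set z : 'rV[R]_2 | z ord0 ord0 < z ord0 ord_max].
(* The sentence: if b = |x|, b <= c and c < r, then x is in A. The radius r is a parameter, while c
   is later taken to be [delta]. *)
apply: (sat_transfer E (FAll 1 (FAll 0 (FAll 0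
    (FImp (FMem (TPair (TVar 2) (TVar 1)) 2)
    (FImp (FMem (TPair (TVar 1) (TPair (TVar 0) (TCst 6))) 3)
    (FImp (FMem (TPair (TVar 0) (TPair (TCst 7) (TCst 6))) 4)
      (FMem (TVar 2) 5)))))))
  (consts [:: base; scode [set: 'rV[R]_n]; sgraph V setT (@enorm R n);
    scode LE; scode LT; scode A; sempty V; satom V r])) =>
    [_ /smem_scode[a _ <-] _ /smem_satoms[b ->] _ /smem_satoms[c ->]|] /=.
  rewrite -!stuple_row2.
  move=> /spair_sgraph[_ <-] /stuple_scode le /stuple_scode lt.
  apply/stuple_scode/rA; move: le lt; rewrite /LE /LT /= !mxE /=.
  exact: le_lt_trans.
rewrite star_empty star_atom !stuple_row2 => h le lt.
by apply: h (star_fun_graph_setT _ _) le lt;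
  [exact: stuple_star_tuples|..]; exact: satom_star_base.
Qed.

Lemma ball_meets_star A :
  (forall r : R, 0 < r -> exists2 y, A y & enorm y <= r) ->
  exists2 x, infinitesimal_ball delta x & star_set E A x.
Proof.
move=> Ar; have [] := delta_inf.
rewrite /infinitesimal_ball /star_lt /star_le /star_rel2 {1}/star_set.
pose LE := [set z : 'rV[R]_2 | z ord0 ord0 <= z ord0 ord_max].
pose LT := [set z : 'rV[R]_2 | z ord0 ord0 < z ord0 ord_max] => dlt _.
(* The sentence: for every c > 0 some x in A has a norm y <= c. It is instantiated at c = [delta],
   whose positivity is [dlt]. *)
apply: (sat_transfer E (FAll 0
    (FImp (FMem (TPair (TCst 6) (TPair (TVar 0) (TCst 5))) 4)
    (FEx 1 (FEx 0 (FAnd (FMem (TPair (TVar 1) (TVar 0)) 2)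
      (FMem (TPair (TVar 0) (TPair (TVar 2) (TCst 5))) 3))))))
  (consts [:: base; scode A; sgraph V setT (@enorm R n);
    scode LE; scode LT; sempty V; satom V 0])) => [_ /smem_satoms[c ->]|] /=.
  rewrite -!stuple_row2 => /stuple_scode; rewrite /LT /= !mxE /=.
  move=> /Ar[x Ax xc].
  exists (stuple V x); first exact/stuple_scode.
  exists (satom V (enorm x)); first exact: satom_base.
  split; first exact/spair_sgraph.
  by rewrite -stuple_row2; apply/stuple_scode; rewrite /LE /= !mxE.
move/(_ _ (satom_star_base delta)); rewrite star_empty star_atom -stuple_row2.
move=> /(_ dlt)[_ /star_codeP[x Ax ->] [_ /smem_star_base[y ->]]].
rewrite -stuple_row2 => -[/star_funE xy yd]; exists x => //=.
by rewrite /star_norm xy.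
Qed.

(** If every standard ball around 0 met A, [ball_meets_star] would put a point of *A in the
    infinitesimal ball. *)
Lemma near_notin A :
  (forall x, infinitesimal_ball delta x -> ~ star_set E A x) ->
  \forall y \near (0 : 'rV[R]_n), ~ A y.
Proof.
move=> dA.
have [r r0 rA] : exists2 r : R, 0 < r & forall y, enorm y <= r -> ~ A y.
  apply: contrapT => nr; have [|x /dA//] := ball_meets_star A.
  move=> r r0; apply: contrapT => nx; apply: nr; exists r => // x xr Ax.
  by apply: nx; exists x.
by apply: filterS (enorm_nbhs r r0) => x /rA.
Qed.

Lemma near_eq_of_ball A B f g :
  nbhs (0 : 'rV[R]_n) A -> nbhs (0 : 'rV[R]_n) B ->
  (forall x, infinitesimal_ball delta x -> star_fun A f x = star_fun B g x) ->
  \forall y \near (0 : 'rV[R]_n), f y = g y.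
Proof.
(* At a point of *D the transferred functions differ, so the infinitesimal ball misses *D. *)
move=> A0 B0 fg; pose D := [set y | [/\ A y, B y & f y <> g y]].
have /near_notin : forall x, infinitesimal_ball delta x -> ~ star_set E D x.
  move=> x xd Dx.
  by apply: (star_fun_neq D A B f g x _ _ _ Dx (fg x xd)) => y [].
by apply: filterS3 A0 B0 => x Ax Bx nD; apply: contrapT => ?; exact: nD.
Qed.

End Transfer.

(** The laws pass to the image of a homomorphism. For standard functions on the ball this replaces a
    transfer of the ring laws to [starR E]. *)
Lemma is_algebra_range (K : pzRingType) (A B : Type) (oA : alg_ops K A)
    (oB : alg_ops K B) (phi : A -> B) :
  is_algebra oA setT ->
  phi (alg0 oA) = alg0 oB ->
  {morph phi : x y / algD oA x y >-> algD oB x y} ->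
  {morph phi : x / algN oA x >-> algN oB x} ->
  {morph phi : x y / algM oA x y >-> algM oB x y} ->
  (forall k, {morph phi : x / algZ oA k x >-> algZ oB k x}) ->
  is_algebra oB (range phi).
Proof.
move=> [_ _ _ _ _ addA addC add0 addN mulA mulC mulD sA s1 sDr sDl sM].
move=> p0 pD pN pM pZ.
split.
- by exists (alg0 oA).
- by move=> _ _ [x _ <-] [y _ <-]; exists (algD oA x y).
- by move=> _ [x _ <-]; exists (algN oA x).
- by move=> _ _ [x _ <-] [y _ <-]; exists (algM oA x y).
- by move=> k _ [x _ <-]; exists (algZ oA k x); rewrite ?pZ.
- by move=> _ _ _ [x _ <-] [y _ <-] [z _ <-]; rewrite -!pD addA.
- by move=> _ _ [x _ <-] [y _ <-]; rewrite -!pD addC.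
- by move=> _ [x _ <-]; rewrite -p0 -pD add0.
- by move=> _ [x _ <-]; rewrite -pN -pD addN ?p0.
- by move=> _ _ _ [x _ <-] [y _ <-] [z _ <-]; rewrite -!pM mulA.
- by move=> _ _ [x _ <-] [y _ <-]; rewrite -!pM mulC.
- by move=> _ _ _ [x _ <-] [y _ <-] [z _ <-]; rewrite -pD -!pM -pD mulD.
- by move=> k l _ [x _ <-]; rewrite -!pZ sA.
- by move=> _ [x _ <-]; rewrite -pZ s1.
- by move=> k _ _ [x _ <-] [y _ <-]; rewrite -pD -!pZ -pD sDr.
- by move=> k l _ [x _ <-]; rewrite -!pZ -pD sDl.
- by move=> k _ _ [x _ <-] [y _ <-]; rewrite -pZ -!pM -pZ sM.
Qed.

(** * The algebra of germs *)

Section Germs.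
Context {R : realType} {n : nat}.

Lemma germ_of_repr (a : germ R n) : germ_of (repr a) = a.
Proof. by rewrite /germ_of reprK. Qed.

Lemma germ_of_surj (a : germ R n) : exists f, a = germ_of f.
Proof. by exists (repr a); rewrite germ_of_repr. Qed.

(** The domains may differ, as they can on the two sides of an algebra law. *)
Lemma eq_germ_of (f g : local_fun R n) : f =1 g -> germ_of f = germ_of g.
Proof.
move=> fg; apply/germ_ofP/same_germP; near=> x; exact: fg.
Unshelve. all: end_near. Qed.

(** On representatives each law becomes a pointwise identity in R. *)
Lemma germ_is_algebra : is_algebra (germ_ops R n) setT.
Proof.
have zeroE : alg0 (germ_ops R n) = germ_of (lf_zero R n) by [].
split=> //.
- move=> a b c _ _ _; have [f ->] := germ_of_surj a.
  have [[g ->] [h ->]] := (germ_of_surj b, germ_of_surj c).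
  rewrite (germ_addE g h) (germ_addE f g) !germ_addE.
  by apply: eq_germ_of => x /=; rewrite addrA.
- move=> a b _ _; have [[f ->] [g ->]] := (germ_of_surj a, germ_of_surj b).
  by rewrite !germ_addE; apply: eq_germ_of => x /=; rewrite addrC.
- move=> a _; have [f ->] := germ_of_surj a.
  by rewrite zeroE germ_addE; apply: eq_germ_of => x /=; rewrite add0r.
- move=> a _; have [f ->] := germ_of_surj a.
  rewrite zeroE (germ_oppE f) germ_addE.
  by apply: eq_germ_of => x /=; rewrite addNr.
- move=> a b c _ _ _; have [f ->] := germ_of_surj a.
  have [[g ->] [h ->]] := (germ_of_surj b, germ_of_surj c).
  rewrite (germ_mulE g h) (germ_mulE f g) !germ_mulE.
  by apply: eq_germ_of => x /=; rewrite mulrA.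
- move=> a b _ _; have [[f ->] [g ->]] := (germ_of_surj a, germ_of_surj b).
  by rewrite !germ_mulE; apply: eq_germ_of => x /=; rewrite mulrC.
- move=> a b c _ _ _; have [f ->] := germ_of_surj a.
  have [[g ->] [h ->]] := (germ_of_surj b, germ_of_surj c).
  rewrite (germ_addE f g) (germ_mulE f h) (germ_mulE g h) germ_mulE germ_addE.
  by apply: eq_germ_of => x /=; rewrite mulrDl.
- move=> k l a _; have [f ->] := germ_of_surj a.
  rewrite (germ_scaleE l f) !germ_scaleE.
  by apply: eq_germ_of => x /=; rewrite mulrA.
- move=> a _; have [f ->] := germ_of_surj a.
  by rewrite germ_scaleE; apply: eq_germ_of => x /=; rewrite mul1r.
- move=> k a b _ _; have [[f ->] [g ->]] := (germ_of_surj a, germ_of_surj b).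
  rewrite (germ_addE f g) (germ_scaleE k f) (germ_scaleE k g).
  rewrite germ_scaleE germ_addE.
  by apply: eq_germ_of => x /=; rewrite mulrDr.
- move=> k l a _; have [f ->] := germ_of_surj a.
  rewrite (germ_scaleE k f) (germ_scaleE l f) germ_scaleE germ_addE.
  by apply: eq_germ_of => x /=; rewrite mulrDl.
- move=> k a b _ _; have [[f ->] [g ->]] := (germ_of_surj a, germ_of_surj b).
  rewrite (germ_mulE f g) (germ_scaleE k f) germ_scaleE germ_mulE.
  by apply: eq_germ_of => x /=; rewrite mulrA.
Qed.

End Germs.

(** * Restriction of germs to the infinitesimal ball *)

Section BallRestriction.
Context {R : realType} {E : nonstandard_extension R} {n : nat}.
Context {delta : starR E}.
Hypothesis delta_inf : pos_infinitesimal delta.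
Local Notation restr := (@ball_restr R E n delta).
Implicit Types f g : local_fun R n.

(** Hence [ball_restr] never meets the default value of [star_fun]. *)
Lemma star_lf_dom f (xi : {x | infinitesimal_ball delta x}) :
  star_set E (lf_dom f) (sval xi).
Proof. exact: ball_star_nbhs delta_inf _ _ (lf_nbhs f) (svalP xi). Qed.

(** Left to right makes the restriction of a germ well defined; right to left makes it injective. *)
Lemma ball_restr_germ f g : same_germ f g <-> restr f = restr g.
Proof.
split=> [[D [D0 Dfg fg]]|fg].
  apply/funext => xi; apply: (eq_star_fun D) => // [x /Dfg[]|x /Dfg[]|] //.
  exact: ball_star_nbhs delta_inf _ _ D0 (svalP xi).
apply/same_germP.
apply: (near_eq_of_ball delta delta_inf _ _ _ _ (lf_nbhs f) (lf_nbhs g)).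
by move=> x xd; have := congr1 (@^~ (exist _ x xd)) fg.
Qed.

Lemma ball_restr0 : restr (lf_zero R n) = alg0 (ball_fun_ops n delta).
Proof. by apply/funext => xi; exact: star_fun_cst. Qed.

Lemma ball_restrD f g :
  restr (lf_add f g) = algD (ball_fun_ops n delta) (restr f) (restr g).
Proof. by apply/funext => xi; apply: star_fun_op2; exact: star_lf_dom. Qed.

Lemma ball_restrN f : restr (lf_opp f) = algN (ball_fun_ops n delta) (restr f).
Proof. by apply/funext => xi; apply: star_fun_opp; exact: star_lf_dom. Qed.

Lemma ball_restrM f g :
  restr (lf_mul f g) = algM (ball_fun_ops n delta) (restr f) (restr g).
Proof. by apply/funext => xi; apply: star_fun_op2; exact: star_lf_dom. Qed.

Lemma ball_restrZ k f :
  restr (lf_scale k f) = algZ (ball_fun_ops n delta) k (restr f).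
Proof.
(* The scalar is seen as a constant function on the whole space, which turns scaling into an
   instance of [star_fun_op2]. *)
apply/funext => xi; rewrite /= -(star_fun_cst k (sval xi)).
rewrite /ball_restr /= -[in LHS](setTI (lf_dom f)).
by apply: star_fun_op2; [exact: star_setT|exact: star_lf_dom].
Qed.

End BallRestriction.

Theorem corollary10p1 (R : realType) (E : nonstandard_extension R)
    (K : Type) (K_infinite : infinite_set [set: K]) (E_sat : saturated E K)
    (n : nat) (delta : starR E) (delta_inf : pos_infinitesimal delta) :
  (forall (U : set 'rV[R]_n) (f : 'rV[R]_n -> R), nbhs (0 : 'rV[R]_n) U ->
     (forall xi : 'rV[starR E]_n, infinitesimal_ball delta xi ->
        star_fun U f xi = std E 0) ->
     exists V : set 'rV[R]_n,
       [/\ nbhs (0 : 'rV[R]_n) V, V `<=` U & forall x, V x -> f x = 0]) /\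
  (exists Rdelta : germ R n -> ball_fun n delta,
     (forall f : local_fun R n, Rdelta (germ_of f) = ball_restr delta f) /\
     is_alg_iso (germ_ops R n) (ball_fun_ops n delta)
       [set: germ R n] (standard_ball_fun n delta) Rdelta).
Proof.
split=> [U f U0 fU|].
  exists (U `&` [set x | f x = 0]); split=> [||x []//]; last exact: subIsetl.
  apply: filterI => //.
  (* Compare [f] with the zero function on the whole space, whose transfer is constantly
     [std E 0]. *)
  apply: (near_eq_of_ball delta delta_inf U setT f (fun=> 0)) => //.
    exact: filterT.
  by move=> x /fU ->; rewrite star_fun_cst.
pose oA := germ_ops R n; pose oB := ball_fun_ops n delta.
(* The map is defined on chosen representatives; [RdeltaE] shows independence of the choice. *)
pose Rdelta (a : germ R n) : ball_fun n delta := ball_restr delta (repr a).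
have RdeltaE f : Rdelta (germ_of f) = ball_restr delta f.
  by apply/(ball_restr_germ delta_inf)/germ_ofP; rewrite germ_of_repr.
have range_Rdelta : range Rdelta = standard_ball_fun n delta.
  apply/seteqP; split=> [_ [a _ <-]|_ [f _ <-]]; first by exists (repr a).
  by exists (germ_of f).
have RdeltaD : {morph Rdelta : x y / algD oA x y >-> algD oB x y}.
  by move=> a b; rewrite RdeltaE ball_restrD.
have RdeltaM : {morph Rdelta : x y / algM oA x y >-> algM oB x y}.
  by move=> a b; rewrite RdeltaE ball_restrM.
have RdeltaN : {morph Rdelta : x / algN oA x >-> algN oB x}.
  by move=> a; rewrite RdeltaE ball_restrN.
have RdeltaZ k : {morph Rdelta : x / algZ oA k x >-> algZ oB k x}.
  by move=> a; rewrite RdeltaE ball_restrZ.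
exists Rdelta; split=> //; split.
- exact: germ_is_algebra.
- rewrite -range_Rdelta.
  apply: (is_algebra_range _ _ _ _ _ Rdelta germ_is_algebra) => //.
  by rewrite RdeltaE ball_restr0.
- split=> [a _|a b _ _ /(ball_restr_germ delta_inf)/germ_ofP|].
  + by rewrite -range_Rdelta; exists a.
  + by rewrite !germ_of_repr.
  + by rewrite -range_Rdelta.
- by move=> a b _ _; exact: RdeltaD.
- by move=> a b _ _; exact: RdeltaM.
- by move=> k a _; exact: RdeltaZ.
Qed.
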